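(* Let $L$ be a non-discrete, compactly generated, topologically simple totally disconnected locally compact group. Then $\mathrm{VZ}(L)=\{1\}$, and therefore $\mathrm{VZ}(G)=\{1\}$ for every open compact subgroup $G$ of $L$.
   Context: For a topological group $L$, the virtual center is $\mathrm{VZ}(L)=\{g\in L: \text{the centralizer of } g \text{ in } L \text{ is open in } L\}$. Compactly generated means generated by a compact subset; topologically simple means non-trivial with no closed normal subgroups other than $\{1\}$ and the whole group. *)

(* Defs.v *)
From HB Require Import structures.
From mathcomp Require Import all_boot.
From mathcomp Require Import all_classical.
From mathcomp Require Import topology.

Set Implicit Arguments.
Unset Strict Implicit.
Unset Printing Implicit Defensive.

Local Open Scope classical_set_scope.
Local Open Scope group_scope.

HB.mixin Record isTopologicalGroup L & Topological L & Group L := {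
  mulg_continuous : continuous (fun x : L * L => x.1 * x.2);
  invg_continuous : continuous (fun x : L => x^-1)
}.

#[short(type="topologicalGroupType")]
HB.structure Definition TopologicalGroup :=
  {L of Topological L & Group L & isTopologicalGroup L}.

(* [groupClosed L] bundles the boolean predicates on [L] that are subgroups;
   classically these are all the subgroups of [L]. *)
Definition subgroup_type (L : groupType) (G : groupClosed L) : Type :=
  {x : L | x \in G}.

Section SubgroupGroup.
Variables (L : groupType) (G : groupClosed L).

HB.instance Definition _ := SubChoice.on (subgroup_type G).

Lemma subgroup_group_closed : group_closed (fun x : L => x \in G).
Proof. by split; [exact: gpred1 | exact: gpredF]. Qed.

HB.instance Definition _ :=
  SubChoice_isSubGroup.Build L (fun x : L => x \in G) (subgroup_type G)
    subgroup_group_closed.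

End SubgroupGroup.

Section SubgroupTopology.
Variables (L : topologicalGroupType) (G : groupClosed L).

HB.instance Definition _ := Topological.copy (subgroup_type G)
  (initial_topology (val : subgroup_type G -> L)).

Lemma subgroup_val_continuous : continuous (val : subgroup_type G -> L).
Proof. exact: initial_continuous. Qed.

Lemma subgroup_continuous (T : topologicalType) (f : T -> subgroup_type G) :
  continuous (fun x => val (f x)) -> continuous f.
Proof.
by move=> /continuousP cf; apply/continuousP => _ [B oB <-]; exact: cf.
Qed.

Lemma subgroup_mulg_continuous :
  continuous (fun x : subgroup_type G * subgroup_type G => x.1 * x.2).
Proof.
apply: subgroup_continuous => x.
apply: (@continuous_comp _ _ _
  (fun x : subgroup_type G * subgroup_type G => (val x.1, val x.2))
  (fun x : L * L => x.1 * x.2)); last exact: mulg_continuous.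
apply: cvg_pair => /=; apply: continuous_comp.
- exact: cvg_fst.
- exact: subgroup_val_continuous.
- exact: cvg_snd.
- exact: subgroup_val_continuous.
Qed.

Lemma subgroup_invg_continuous :
  continuous (fun x : subgroup_type G => x^-1).
Proof.
apply: subgroup_continuous => x.
apply: (@continuous_comp (subgroup_type G) L L val (fun x : L => x^-1)).
- exact: subgroup_val_continuous.
- exact: invg_continuous.
Qed.

HB.instance Definition _ := isTopologicalGroup.Build (subgroup_type G)
  subgroup_mulg_continuous subgroup_invg_continuous.

End SubgroupTopology.

(* The condition of the library structure [discreteTopologicalType]. *)
Definition discrete_space (T : topologicalType) : Prop :=
  @nbhs T T = principal_filter.

Definition generated_subgroup (L : groupType) (K : set L) : set L :=
  \bigcap_(H in [set H : groupClosed L | K `<=` [set` H]]) [set` H].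

Definition compactly_generated (L : topologicalGroupType) : Prop :=
  exists2 K : set L, compact K & generated_subgroup K = [set: L].

Definition normal_subgroup (L : groupType) (N : groupClosed L) : Prop :=
  forall x y : L, x \in N -> x ^ y \in N.

Definition topologically_simple (L : topologicalGroupType) : Prop :=
  [set: L] <> [set 1] /\
  forall N : groupClosed L, normal_subgroup N -> closed [set` N] ->
    [set` N] = [set 1] \/ [set` N] = [set: L].

Definition centralizer (L : groupType) (g : L) : set L :=
  [set x | commute g x].

Definition virtual_center (L : topologicalGroupType) : set L :=
  [set g : L | open (centralizer g)].
Arguments virtual_center L : clear implicits.

(* Main.v *)
(* If the virtual center VZ(L) is nontrivial, its closure is a nontrivial closed
   normal subgroup, so it is dense by simplicity. By van Dantzig, L has a proper
   compact open subgroup G; a compact generating set K is covered by finitely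
   many cosets zG with z in VZ(L). Those z centralize a common neighbourhood U
   of 1. Let C be the intersection of the centralizers of all elements that
   centralize U: it is an open subgroup, and the intersection N of G with the
   conjugates of C by G is still open since G is compact. Both G and the z
   normalize N, so N is an open normal subgroup of L contained in G, hence
   trivial, and L is discrete. *)
Require Import Defs.
From mathcomp Require Import all_boot.
From mathcomp Require Import all_classical.
From mathcomp Require Import topology.

Set Implicit Arguments.
Unset Strict Implicit.
Unset Printing Implicit Defensive.

Local Open Scope classical_set_scope.

(** * Compactness and quasi-components in topological spaces *)

Section CompactSpaces.
Context {T : topologicalType}.

(** Each point of [A] lies outside [closure V] for some [V] in [F]; near-covering compactness along
    the small members of [F] makes one [V] serve all of [A]. *)
Lemma compact_disjoint_closure (A : set T) (F : set_system T) :
  ProperFilter F -> compact A -> (forall a, A a -> ~ cluster F a) ->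
  exists2 V, F V & A `&` closure V = set0.
Proof.
move=> FF /compact_near_coveringP cA clF.
have [a Aa|] :=
    cA _ (powerset_filter_from F) (fun V a => ~ closure V a) _.
  have [V FV nVa] : exists2 V, F V & ~ closure V a.
    apply: contrapT => nV; apply: (clF _ Aa); rewrite clusterE => V FV.
    by apply: contrapT => nVa; apply: nV; exists V.
  exists (~` closure V, [set W | F W /\ W `<=` V]).
    split; last exact: powerset_filter_fromP.
    by apply: open_nbhs_nbhs; split => //; exact/closed_openC/closed_closure.
  by move=> [x W] /= [nVx [_ WV]] /(closureS WV).
move=> M [MF _ [V MV]] AV; exists V; first exact: MF.
by apply/disjoints_subset => x Ax; exact: AV.
Qed.

(** The previous lemma is used twice: for [A] against the neighbourhoods of each point of [B], and
    for [B] against the neighbourhoods of [A]. *)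
Lemma compact_separation (A B : set T) :
  hausdorff_space T -> compact A -> compact B -> A `&` B = set0 ->
  exists U V, [/\ open U, open V, A `<=` U, B `<=` V & U `&` V = set0].
Proof.
move=> hT cA cB AB0.
(* Empty [A] is treated apart, since its neighbourhood filter is not proper. *)
have [[a Aa]|A0] := pselect (A !=set0); last first.
  exists set0, setT; split; [exact: open0|exact: openT| |by []|exact: set0I].
  by move=> x Ax; case: A0; exists x.
have [|b Bb clb|W nW BW] := compact_disjoint_closure (F := set_nbhs A) _ cB.
- by apply: set_nbhs_pfilter; exists a.
- have [|V nV AV] := @compact_disjoint_closure A (nbhs b) _ cA.
    move=> x Ax /hT bx; have : (A `&` B) b by split => //; rewrite bx.
    by rewrite AB0.
  have [|x [/= nVx Vx]] := clb (~` closure V) V _ nV.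
    apply/set_nbhsP; exists (~` closure V); split => //.
      exact/closed_openC/closed_closure.
    exact/disjoints_subset.
  exact/nVx/subset_closure.
have [C [oC AC CW]] := (set_nbhsP _ _).1 nW.
exists C, (~` closure W); split => //.
- exact/closed_openC/closed_closure.
- exact/disjoints_subset.
- by apply/disjoints_subset => x /CW /subset_closure; rewrite setCK.
Qed.

(** For closed [K] this says that [D] is clopen in the subspace [K]. *)
Definition rel_clopen (K D : set T) :=
  [/\ D `<=` K, closed D & closed (K `\` D)].

Lemma rel_clopenI (K D E : set T) :
  rel_clopen K D -> rel_clopen K E -> rel_clopen K (D `&` E).
Proof.
move=> [DK cD cKD] [EK cE cKE]; split; first by move=> x [/DK].
  exact: closedI.
by rewrite setDIr; exact: closedU.
Qed.

Definition quasi_component (K : set T) (x : T) :=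
  \bigcap_(D in [set D | rel_clopen K D /\ D x]) D.

Definition rel_clopen_filter (K : set T) (x : T) :=
  filter_from [set D | rel_clopen K D /\ D x] id.

Lemma rel_clopen_filter_proper (K : set T) (x : T) :
  closed K -> K x -> ProperFilter (rel_clopen_filter K x).
Proof.
move=> cK Kx; apply: filter_from_proper; last by move=> D [_ Dx]; exists x.
apply: filter_from_filter.
  by exists K; split => //; split => //; rewrite setDv; exact: closed0.
move=> D E [rD Dx] [rE Ex]; exists (D `&` E) => //.
by split => //; exact: rel_clopenI.
Qed.

(** A cluster point in [K \ O] of the relatively clopen sets through [x] would belong to all of
    them, hence to the quasi-component, hence to [O]. *)
Lemma rel_clopen_subset (K O : set T) (x : T) :
  closed K -> K x -> compact (K `\` O) -> quasi_component K x `<=` O ->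
  exists D, [/\ rel_clopen K D, D x & D `<=` O].
Proof.
move=> cK Kx cKO QO.
have PF := rel_clopen_filter_proper cK Kx.
have [a [Ka nOa] cla|V [D [rD Dx] DV] KOV] := compact_disjoint_closure PF cKO.
  apply: nOa; apply: QO => D [rD Dx]; have [_ cD _] := rD.
  by apply: cD; move: cla; rewrite clusterE; apply; exists D.
exists D; split => // y Dy; apply: contrapT => nOy.
have : ((K `\` O) `&` closure V) y.
  split; last by apply: subset_closure; exact: DV.
  by case: rD => DK _ _; split => //; exact: DK.
by rewrite KOV.
Qed.

(** Separate [A] and [B] by disjoint open [U] and [V]. A relatively clopen [D] through [x] inside
    their union stays relatively clopen when cut by [U], and the cut misses [B]. *)
Lemma quasi_component_split (K A B : set T) (x : T) :
  hausdorff_space T -> compact K -> K x -> closed A -> closed B ->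
  quasi_component K x = A `|` B -> A `&` B = set0 -> A x -> B = set0.
Proof.
move=> hT cK Kx cA cB QAB AB0 Ax; have clK := compact_closed hT cK.
have QK : quasi_component K x `<=` K.
  by apply: bigcap_inf; split => //; split => //; rewrite setDv; exact: closed0.
have AK : A `<=` K by apply: subset_trans QK; rewrite QAB; exact: subsetUl.
have BK : B `<=` K by apply: subset_trans QK; rewrite QAB; exact: subsetUr.
have cptA := subclosed_compact cA cK AK.
have cptB := subclosed_compact cB cK BK.
have [U [V [oU oV AU BV UV0]]] := compact_separation hT cptA cptB AB0.
have cKO : compact (K `\` (U `|` V)).
  apply: (subclosed_compact _ cK) => //.
  by apply: closedI => //; apply: open_closedC; exact: openU.
have [|D [[DK cD cKD] Dx DUV]] := rel_clopen_subset clK Kx cKO.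
  by rewrite QAB => y [/AU|/BV]; [left|right].
have rDU : rel_clopen K (D `&` U).
  split; first by move=> y [/DK].
    have -> : D `&` U = D `&` ~` V.
      apply/seteqP; split => y [Dy].
        move=> Uy; split => // Vy.
        by have : (U `&` V) y by []; rewrite UV0.
      by have [] := DUV _ Dy.
    by apply: closedI => //; exact: open_closedC.
  rewrite setDIr; apply: closedU => //; apply: closedI => //.
  exact: open_closedC.
rewrite -subset0 => y By.
have : quasi_component K x y by rewrite QAB; right.
move=> /(_ (D `&` U)) []; first by split => //; split => //; exact: AU.
by move=> _ Uy; have : (U `&` V) y by [split => //; exact: BV]; rewrite UV0.
Qed.

Lemma quasi_component_closed (K : set T) (x : T) : closed (quasi_component K x).
Proof. by apply: closed_bigI => D [[]]. Qed.

(** A relatively clopen [B] splits the quasi-component into two closed pieces, and the piece without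
    [x] must be empty. *)
Lemma quasi_component_connected (K : set T) (x : T) :
  hausdorff_space T -> compact K -> K x -> connected (quasi_component K x).
Proof.
move=> hT cK Kx B [b Bb] [C oC BC] [E cE BE].
set Q := quasi_component K x in BC BE *.
have cQ : closed Q by exact: quasi_component_closed.
have cB : closed B by rewrite BE; exact: closedI.
have cB' : closed (Q `\` B).
  by rewrite BC setDIr setDv set0U; apply: closedI => //; exact: open_closedC.
have BQ : B `<=` Q by rewrite BC; exact: subIsetl.
have Qx : Q x by move=> D [].
have [Bx|nBx] := pselect (B x).
  have QB : Q `\` B = set0.
    apply: (@quasi_component_split K B _ x) => //.
      by rewrite setUDr setDv setD0; apply/esym/setUidPr.
    by rewrite setIDA setIC -setIDA setDv setI0.
  by apply/seteqP; split => //; rewrite -setD_eq0.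
have : B = set0.
  apply: (@quasi_component_split K (Q `\` B) _ x) => //.
    rewrite setUC; apply/seteqP; split => y; last by case=> [/BQ|[]].
    by move=> Qy; have [?|?] := pselect (B y); [left|right].
  by rewrite setDE -setIA setICl setI0.
by move=> B0; move: Bb; rewrite B0.
Qed.

(* The quasi-component of [x] in a compact neighbourhood is connected, hence
   reduced to [x], and compactness shrinks one of the relatively clopen sets
   through [x] into [O]. *)
Lemma totally_disconnected_compact_open_nbhs (x : T) (O : set T) :
  hausdorff_space T -> totally_disconnected [set: T] ->
  locally_compact [set: T] -> nbhs x O ->
  exists W, [/\ compact W, open W, W x & W `<=` O].
Proof.
move=> hT tdT lcT nO.
have [K + [cK clK]] := lcT x I; rewrite withinET => nK.
have Kx : K x by exact: nbhs_singleton.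
have nKO : nbhs x (K° `&` O°).
  by apply: filterI; apply: open_nbhs_nbhs; split => //; exact: open_interior.
have [|y Qy|D [[DK cD cKD] Dx DO]] := @rel_clopen_subset K (K° `&` O°) x clK Kx.
- apply: (subclosed_compact _ cK) => //; apply: closedI => //.
  by apply: open_closedC; apply: openI; exact: open_interior.
- have : connected_component [set: T] x y.
    apply: (@connected_component_max _ _ (quasi_component K x)) => //.
      by move=> D [].
    exact: quasi_component_connected.
  by rewrite tdT// => ->; exact: nbhs_singleton.
exists D; split => //; last by move=> y /DO [_ /interior_subset].
  exact: subclosed_compact cD cK DK.
have -> : D = K° `&` ~` (K `\` D).
  apply/seteqP; split=> y; first by move=> Dy; split; [case: (DO _ Dy)|case].
  by move=> [/interior_subset Ky nKD]; apply: contrapT => nDy; exact: nKD.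
by apply: openI; [exact: open_interior|exact: closed_openC].
Qed.

End CompactSpaces.

Local Open Scope group_scope.

(** * Subgroups as sets *)

Section Subgroups.
Variable L : groupType.

Definition is_subgroup (A : set L) :=
  [/\ A 1, forall x y, A x -> A y -> A (x * y) & forall x, A x -> A x^-1].

(** Lets simplicity, which quantifies over [groupClosed], apply to subgroups built as sets;
    classical decision makes membership boolean. *)
Lemma groupClosed_of_set (A : set L) :
  is_subgroup A -> exists H : groupClosed L, [set` H] = A.
Proof.
move=> [A1 AM AV]; pose S : {pred L} := [pred x | `[< A x >]].
have S1 : 1 \in S by apply/asboolP.
have SM : mulg_closed S by move=> x y /asboolP Ax /asboolP Ay; apply/asboolP/AM.
have SV : invg_closed S by move=> x /asboolP Ax; apply/asboolP/AV.
pose m1 := isMul1Closed.Build L S S1.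
pose m2 := isMulClosed.Build L S SM.
pose m3 := isInvClosed.Build L S SV.
exists (GroupClosed.Pack (GroupClosed.Class m3 m1 m2)).
by apply/seteqP; split => x /=; [move=> /asboolP|move=> Ax; apply/asboolP].
Qed.

Lemma centralizer_is_subgroup (g : L) : is_subgroup (centralizer g).
Proof.
by split=> [|x y|x]; [exact: commute1|exact: commuteM|exact: commuteV].
Qed.

Lemma bigcap_is_subgroup I (P : set I) (A : I -> set L) :
  (forall i, P i -> is_subgroup (A i)) -> is_subgroup (\bigcap_(i in P) A i).
Proof.
move=> sA; split=> [i /sA[]//|x y Ax Ay i Pi|x Ax i Pi].
  by have [_ AM _] := sA i Pi; apply: AM; [exact: Ax|exact: Ay].
by have [_ _ AV] := sA i Pi; apply: AV; exact: Ax.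
Qed.

Lemma conjg_preimage_is_subgroup (A : set L) (y : L) :
  is_subgroup A -> is_subgroup [set x | A (x ^ y)].
Proof.
move=> [A1 AM AV]; split=> [|x z|x] /=; rewrite ?conj1g ?conjMg ?conjVg //.
  exact: AM.
exact: AV.
Qed.

Lemma subgroupI (A B : set L) :
  is_subgroup A -> is_subgroup B -> is_subgroup (A `&` B).
Proof.
move=> [A1 AM AV] [B1 BM BV]; split=> // [x y [Ax Bx] [Ay By]|x [Ax Bx]].
  by split; [exact: AM|exact: BM].
by split; [exact: AV|exact: BV].
Qed.

(** For a subgroup this is the normalizer; the equivalence yields closure under inverses at once. *)
Definition setwise_stabilizer (A : set L) :=
  [set y | forall x, (A (x ^ y) <-> A x)].

Lemma setwise_stabilizer_is_subgroup (A : set L) :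
  is_subgroup (setwise_stabilizer A).
Proof.
split=> [x|y z sy sz x|y sy x]; first by rewrite conjg1.
- by rewrite conjgM sz sy.
- by rewrite -sy conjgKV.
Qed.

Lemma generated_subgroup_sub (K A : set L) :
  is_subgroup A -> K `<=` A -> generated_subgroup K `<=` A.
Proof. by move=> /groupClosed_of_set[H <-] KH x /(_ H KH). Qed.

End Subgroups.

(** * Topological groups and their open subgroups *)

Section TopologicalGroups.
Variable L : topologicalGroupType.
Implicit Types (A K O : set L) (x y z g : L).

Lemma continuous_mulg (T : topologicalType) (f g : T -> L) :
  continuous f -> continuous g -> continuous (fun t => f t * g t).
Proof.
move=> cf cg t; apply: (@continuous_comp _ _ _ (fun t => (f t, g t))
  (fun x : L * L => x.1 * x.2)); last exact: mulg_continuous.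
by apply: cvg_pair; [exact: cf|exact: cg].
Qed.

Lemma continuous_invg (T : topologicalType) (f : T -> L) :
  continuous f -> continuous (fun t => (f t)^-1).
Proof.
move=> cf t; apply: (@continuous_comp _ _ _ f (fun x : L => x^-1)).
  exact: cf.
exact: invg_continuous.
Qed.

Lemma continuous_mulgl y : continuous (fun x => y * x).
Proof. by apply: continuous_mulg; [exact: cst_continuous|move=> x; exact: cvg_id]. Qed.

Lemma continuous_conjgl y : continuous (fun x => x ^ y).
Proof.
apply: continuous_mulg; first exact: cst_continuous.
by apply: continuous_mulg; [move=> x; exact: cvg_id|exact: cst_continuous].
Qed.

Lemma continuous_conjg : continuous (fun p : L * L => p.2 ^ p.1).
Proof.
apply: continuous_mulg; first by apply: continuous_invg => x; exact: cvg_fst.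
by apply: continuous_mulg => x; [exact: cvg_snd|exact: cvg_fst].
Qed.

Lemma nbhs_mulVg (A : set L) x : nbhs 1 A -> nbhs x [set y | A (x^-1 * y)].
Proof. by move=> nA; apply: continuous_mulgl; rewrite mulVg. Qed.

(** The tube lemma: compactness of [K] makes the neighbourhoods of [x] found for each [k]
    uniform. *)
Lemma near_compact_image (f : L * L -> L) (K O : set L) x :
  continuous f -> compact K -> open O -> (forall k, K k -> O (f (k, x))) ->
  \forall y \near x, forall k, K k -> O (f (k, y)).
Proof.
move=> cf /compact_near_coveringP cK oO Kx.
apply: (cK _ (nbhs x) (fun y k => O (f (k, y)))) => k /Kx Okx.
have : nbhs (k, x) (f @^-1` O) by apply: cf; exact: open_nbhs_nbhs.
by apply: filterS => -[].
Qed.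

Lemma subgroup_open (A : set L) : is_subgroup A -> nbhs 1 A -> open A.
Proof.
move=> [A1 AM AV] nA; rewrite openE => x Ax.
by apply: filterS (nbhs_mulVg x nA) => y /(AM _ _ Ax); rewrite mulVKg.
Qed.

Lemma open_subgroup_closed (A : set L) : is_subgroup A -> open A -> closed A.
Proof.
move=> [A1 AM AV] oA x clAx.
have [|y [Ay /= Axy]] := clAx [set y | A (x^-1 * y)].
  by apply: nbhs_mulVg; exact: open_nbhs_nbhs.
by have := AM _ _ Ay (AV _ Axy); rewrite invgM invgK mulVKg.
Qed.

Lemma closure_is_subgroup (A : set L) : is_subgroup A -> is_subgroup (closure A).
Proof.
move=> [A1 AM AV]; split; first exact: subset_closure.
- move=> x y Ax Ay O nO.
  have : \forall p \near (x, y), O (p.1 * p.2).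
    exact: (@mulg_continuous L (x, y)).
  move=> [[U V] /= [nU nV] UV].
  have [u [Au Uu]] := Ax U nU; have [v [Av Vv]] := Ay V nV.
  by exists (u * v); split; [exact: AM|exact: (UV (u, v))].
- move=> x Ax O nO.
  have [y [Ay Oy]] := Ax [set y | O y^-1] (@invg_continuous L x O nO).
  by exists y^-1; split => //; exact: AV.
Qed.

Lemma closure_conjg (A : set L) y :
  (forall x, A x -> A (x ^ y)) -> forall x, closure A x -> closure A (x ^ y).
Proof.
move=> AJ x Ax O nO; have [z [Az Oz]] := Ax _ (@continuous_conjgl y x O nO).
by exists (z ^ y); split => //; exact: AJ.
Qed.

(** The diagonal is closed, being the preimage of 1 under the map sending (x, y) to x^-1 * y. *)
Lemma hausdorff_of_closed1 : closed [set 1 : L] -> hausdorff_space L.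
Proof.
move=> c1 p q clpq; apply: contrapT => pq.
have cf : continuous (fun x : L * L => x.1^-1 * x.2).
  apply: continuous_mulg; first by apply: continuous_invg => x; exact: cvg_fst.
  by move=> x; exact: cvg_snd.
have [] : nbhs (p, q) ((fun x : L * L => x.1^-1 * x.2) @^-1` ~` [set 1]).
  apply: cf; apply: open_nbhs_nbhs; split; first exact: closed_openC.
  by move=> /= e; apply: pq; rewrite -[q](mulVKg p) e mulg1.
move=> [U V] /= [nU nV] UV; have [x [Ux Vx]] := clpq U V nU nV.
by apply: (UV (x, x)) => //=; rewrite mulVg.
Qed.

Lemma totally_disconnected_hausdorff :
  totally_disconnected [set: L] -> hausdorff_space L.
Proof.
move=> tdL; apply: hausdorff_of_closed1; rewrite -(tdL 1)//.
exact/component_closed/closedT.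
Qed.

(* The subgroup is the right stabilizer of a compact open set [W]. *)
Lemma compact_open_subgroup_nbhs (O : set L) :
  totally_disconnected [set: L] -> locally_compact [set: L] -> nbhs 1 O ->
  exists G, [/\ is_subgroup G, open G, compact G & G `<=` O].
Proof.
move=> tdL lcL nO.
have hL := totally_disconnected_hausdorff tdL.
have [W [cW oW W1 WO]] :=
  totally_disconnected_compact_open_nbhs hL tdL lcL nO.
pose G := [set y : L | forall x, W (x * y) <-> W x].
have sG : is_subgroup G.
  split=> [x|y z Gy Gz x|y Gy x]; first by rewrite mulg1.
  - by rewrite mulgA Gz Gy.
  - by rewrite -Gy mulgVK.
have GW : G `<=` W by move=> y /(_ 1); rewrite mul1g => ->.
(* For [y] near 1, the tube lemma gives that both [y] and [y^-1] move compact [W] into open [W]: one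
   direction of the equivalence each. *)
have nG : nbhs 1 G.
  have c1 : continuous (fun p : L * L => p.1 * p.2) by exact: mulg_continuous.
  have c2 : continuous (fun p : L * L => p.1 * p.2^-1).
    apply: continuous_mulg => [x|]; first exact: cvg_fst.
    by apply: continuous_invg => x; exact: cvg_snd.
  have n1 : \forall y \near (1 : L), forall w, W w -> W (w * y).
    by apply: (near_compact_image c1) => //= w; rewrite mulg1.
  have n2 : \forall y \near (1 : L), forall w, W w -> W (w * y^-1).
    by apply: (near_compact_image c2) => //= w; rewrite invg1 mulg1.
  apply: filterS2 n1 n2 => y Wy WyV x; split; last exact: Wy.
  by move=> /WyV; rewrite mulgK.
have oG := subgroup_open sG nG.
exists G; split => //; last exact: subset_trans GW WO.
exact: subclosed_compact (open_subgroup_closed sG oG) cW GW.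
Qed.

Lemma discrete_of_open1 : open [set 1 : L] -> discrete_space L.
Proof.
move=> o1; apply/funext => x; apply/seteqP; split => A.
  by move=> /nbhs_singleton Ax _ ->.
move=> /(_ _ erefl) Ax; have : nbhs x [set y | [set 1] (x^-1 * y)].
  by apply: nbhs_mulVg; exact: open_nbhs_nbhs.
by apply: filterS => y /= e; rewrite -[y](mulVKg x) e mulg1.
Qed.

(** * The virtual center and its density *)

Lemma virtual_centerP g :
  virtual_center L g <-> nbhs 1 (centralizer g).
Proof.
split; first by move=> oC; apply: open_nbhs_nbhs; split => //; exact: commute1.
(* A centralizer is a subgroup, so it is open once it is a neighbourhood of 1. *)
exact/subgroup_open/centralizer_is_subgroup.
Qed.

Lemma virtual_center_is_subgroup : is_subgroup (virtual_center L).
Proof.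
split=> [|x y /virtual_centerP nx /virtual_centerP ny|x /virtual_centerP nx].
- apply/virtual_centerP; apply: filterS filterT => x _.
  exact/commute_sym/commute1.
- apply/virtual_centerP; apply: filterS2 nx ny => z cx cy.
  by apply/commute_sym/commuteM; exact: commute_sym.
- apply/virtual_centerP; apply: filterS nx => z cx.
  exact/commute_sym/commuteV/commute_sym.
Qed.

Lemma virtual_center_conjg x y : virtual_center L x -> virtual_center L (x ^ y).
Proof.
move=> /virtual_centerP nx; apply/virtual_centerP.
have : \forall z \near (1 : L), centralizer x (z ^ y^-1).
  by apply: continuous_conjgl; rewrite conj1g.
apply: filterS => z; rewrite /centralizer /= /commute.
by move=> /(congr1 (conjg^~ y)) /=; rewrite (conjMg x) (conjMg _ x) conjgKV.
Qed.

Lemma virtual_center_dense :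
  topologically_simple L -> virtual_center L <> [set 1] ->
  closure (virtual_center L) = [set: L].
Proof.
move=> [_ simpleL] VZ1.
have sVZ := virtual_center_is_subgroup.
have [H HE] := groupClosed_of_set (closure_is_subgroup sVZ).
have nH : normal_subgroup H.
  move=> x y xH; have : closure (virtual_center L) x by rewrite -HE.
  move=> /(@closure_conjg _ y (fun x => @virtual_center_conjg x y)).
  by rewrite -HE.
have [|H1|<-//] := simpleL H nH; first by rewrite HE; exact: closed_closure.
exfalso; apply: VZ1; rewrite -H1 HE; apply/seteqP; split.
  exact: subset_closure.
by rewrite -HE H1 => _ ->; case: sVZ.
Qed.

(* Density of the virtual center lets every coset [k G] be represented by an
   element with open centralizer, and finitely many cosets cover [K]. *)
Lemma common_centralized_nbhs (K G : set L) :
  closure (virtual_center L) = [set: L] -> compact K -> is_subgroup G ->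
  open G ->
  exists2 U, nbhs 1 U & forall k, K k ->
    exists2 z, G (z^-1 * k) & U `<=` centralizer z.
Proof.
move=> dVZ /compact_near_coveringP cK [G1 GM GV] oG.
(* The property passes to smaller [U], so it may be proved for all small [U], the form in which
   compactness of [K] applies. *)
apply/near_powerset_filter_fromP.
  move=> A B AB PB k /PB[z Gz Bz]; exists z => //; exact: subset_trans AB Bz.
apply: (cK _ _
  (fun U k => exists2 z, G (z^-1 * k) & U `<=` centralizer z)) => k _.
have [z [VZz /= Gkz]] : (virtual_center L `&` [set z | G (k^-1 * z)]) !=set0.
  have : closure (virtual_center L) k by rewrite dVZ.
  by apply; apply: nbhs_mulVg; exact: open_nbhs_nbhs.
exists ([set x | G (z^-1 * x)], [set U | U `<=` centralizer z]); last first.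
  by move=> [x U] /= [Gx Uz]; exists z.
split => /=; last exact/small_set_sub/virtual_centerP.
apply: (@continuous_mulgl z^-1); apply: open_nbhs_nbhs; split => //.
by rewrite -[z^-1 * k]invgK invgM invgK; exact: GV.
Qed.

(** * The core of [C] under conjugation by [G] *)

Definition core (G C : set L) := G `&` \bigcap_(y in G) [set x | C (x ^ y)].

Lemma core_is_subgroup G C : is_subgroup G -> is_subgroup C ->
  is_subgroup (core G C).
Proof.
move=> sG sC; apply: subgroupI => //; apply: bigcap_is_subgroup => y _.
exact: conjg_preimage_is_subgroup.
Qed.

(** All conjugates of 1 equal 1, so the tube lemma over compact [G] puts every [x ^ y] in [C] at
    once for [x] near 1. *)
Lemma core_nbhs G C : compact G -> nbhs 1 G -> nbhs 1 C -> nbhs 1 (core G C).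
Proof.
move=> cG nG nC; apply: filterI => //.
have : \forall x \near (1 : L), forall y, G y -> C° (x ^ y).
  apply: (near_compact_image continuous_conjg) => //=.
    exact: open_interior.
  by move=> k _; rewrite conj1g.
by apply: filterS => x Cx y /Cx /interior_subset.
Qed.

(** Conjugation by an element of [G] preserves [G] and permutes the conjugates of [C] being
    intersected. *)
Lemma core_stabilizer G C : is_subgroup G ->
  G `<=` setwise_stabilizer (core G C).
Proof.
move=> [G1 GM GV].
have GJ x y : G x -> G y -> G (x ^ y).
  by move=> Gx Gy; apply: (GM _ _ (GV _ Gy)); exact: GM.
have coreJ x y : G y -> core G C x -> core G C (x ^ y).
  move=> Gy [Gx Cx]; split; first exact: GJ.
  by move=> z Gz /=; rewrite -conjgM; apply: Cx; exact: GM.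
move=> y Gy x; split; last exact: coreJ.
by move=> /(coreJ _ _ (GV _ Gy)); rewrite conjgK.
Qed.

(** The conjugate by 1 shows that the core lies in [C], so conjugation by [z] fixes it pointwise. *)
Lemma core_centralizer G C z : is_subgroup G -> C `<=` centralizer z ->
  setwise_stabilizer (core G C) z.
Proof.
move=> [G1 _ _] Cz.
have fix_core x : core G C x -> commute z x.
  by move=> [_ /(_ 1 G1)] /=; rewrite conjg1 => /Cz.
have fixJ x : commute z x -> x ^ z = x.
  by move=> zx; apply/conjg_fixP/commgP/commute_sym.
move=> x; split => [Nx|Nx]; last by rewrite fixJ//; exact: fix_core.
(* Here [x ^ z] is itself fixed by [z], so injectivity of conjugation gives [x ^ z = x]. *)
have := fix_core _ Nx => /fixJ /conjg_inj xz.
by rewrite -xz.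
Qed.

(** * Triviality of the virtual center *)

Lemma virtual_center_trivial :
  ~ discrete_space L -> compactly_generated L -> topologically_simple L ->
  totally_disconnected [set: L] -> locally_compact [set: L] ->
  virtual_center L = [set 1].
Proof.
move=> ndL [K cK genK] simpleL tdL lcL; apply: contrapT => VZ1.
have hL := totally_disconnected_hausdorff tdL.
have [ntL simL] := simpleL.
have [a a1] : exists a : L, a <> 1.
  apply: contrapT => na; apply: ntL; apply/seteqP; split => // x _ /=.
  by apply: contrapT => x1; apply: na; exists x.
(* Keeping [a] out of [G] makes [G] proper. *)
have nO : nbhs 1 (~` [set a]).
  apply: open_nbhs_nbhs; split; last by move=> /esym.
  exact/closed_openC/accessible_closed_set1/hausdorff_accessible.
have [G [sG oG cG Ga]] := compact_open_subgroup_nbhs tdL lcL nO.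
have G1 : G 1 by case: sG.
have dVZ := virtual_center_dense simpleL VZ1.
have [U nU KU] := common_centralized_nbhs dVZ cK sG oG.
(* The double centralizer of [U]: it contains [U], and every [z] supplied by [KU] centralizes it. *)
pose C := \bigcap_(z in [set z | U `<=` centralizer z]) centralizer z.
have sC : is_subgroup C.
  by apply: bigcap_is_subgroup => z _; exact: centralizer_is_subgroup.
have nC : nbhs 1 C by apply: filterS nU => x Ux z /(_ _ Ux).
have sN := core_is_subgroup sG sC.
have nN : nbhs 1 (core G C) by apply: core_nbhs => //; exact: open_nbhs_nbhs.
have sM := setwise_stabilizer_is_subgroup (core G C).
have KM : K `<=` setwise_stabilizer (core G C).
  (* Write [k] as [z] times an element of [G]; each factor normalizes the core for its own
     reason. *)
  move=> k /KU[z Gzk Uz]; rewrite -[k](mulVKg z); case: sM => _ MM _; apply: MM.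
    by apply: core_centralizer => // x; exact.
  exact: core_stabilizer.
have oN := subgroup_open sN nN.
have cN := open_subgroup_closed sN oN.
have [H HE] := groupClosed_of_set sN.
have nH : normal_subgroup H.
  move=> x y xH; have : core G C x by rewrite -HE.
  have My : setwise_stabilizer (core G C) y.
    by apply: (generated_subgroup_sub sM KM); rewrite genK.
  by rewrite -(My x) -HE.
(* A trivial core makes 1 an isolated point; a core equal to [L] would contain [a]. *)
have [||] := simL H nH; rewrite HE // => N1.
  by apply/ndL/discrete_of_open1; rewrite -N1.
have : core G C a by rewrite N1.
by move=> [/Ga /(_ erefl)].
Qed.

(** The centralizer in [G] is the trace of an open set [B] of [L]; as [G] is open, its intersection
    with [B] is a neighbourhood of 1 in [L] centralizing [g]. *)
Lemma virtual_center_open_subgroup (G : groupClosed L) (g : subgroup_type G) :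
  open [set` G] -> virtual_center (subgroup_type G) g ->
  virtual_center L (val g).
Proof.
move=> oG [B oB BE]; apply/virtual_centerP.
have B1 : B 1.
  by have : (val @^-1` B) (1 : subgroup_type G) by rewrite BE; exact: commute1.
have : nbhs 1 (B `&` [set` G]).
  by apply: open_nbhs_nbhs; split; [exact: openI|split => //; exact: gpred1].
apply: filterS => x [Bx Gx].
have : (val @^-1` B) (exist _ x Gx : subgroup_type G) by [].
by rewrite BE => /(congr1 val).
Qed.

End TopologicalGroups.

Local Close Scope group_scope.

Theorem theorem4p8 (L : topologicalGroupType) :
  ~ discrete_space L ->
  compactly_generated L ->
  topologically_simple L ->
  totally_disconnected [set: L] ->
  locally_compact [set: L] ->
  virtual_center L = [set 1%g] /\
  (forall G : groupClosed L, open [set` G] -> compact [set` G] ->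
     virtual_center (subgroup_type G) = [set 1%g]).
Proof.
move=> ndL cgL sL tdL lcL.
have VZL := virtual_center_trivial ndL cgL sL tdL lcL.
split=> // G oG _; apply/seteqP; split => g.
  move=> /(virtual_center_open_subgroup oG); rewrite VZL => /= g1.
  by apply: val_inj; exact: g1.
by move=> ->; case: (virtual_center_is_subgroup (subgroup_type G)).
Qed.
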